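(* Let $\Phi=(\Gamma,\phi)$ be a $\mathbb{T}^{1}$-gain graph on a finite simple graph $\Gamma$. If $\lambda$ is an eigenvalue of $A(\Lambda(\Phi))$ (that is, of $A(\Psi)$ for any gain graph $\Psi$ in the switching class $\Lambda(\Phi)$), then $-2\le\lambda$.
   Context: All graphs are finite and simple. $\mathbb{T}=\{z\in\mathbb{C}:|z|=1\}$ under multiplication; $\mathbb{T}^{1}$ denotes the group $\mathbb{T}$ together with the distinguished element $\mathfrak{s}=1$ (the superscript only records this choice). For an edge $e=v_iv_j$ of a graph $\Gamma=(V,E)$, write $e_{ij}$ both for the edge and for the oriented edge from $v_i$ to $v_j$. A $\mathbb{T}^{\mathfrak{s}}$-gain graph $\Phi=(\Gamma,\phi)$ is a graph $\Gamma$ with a function $\phi$ from the oriented edges (two opposite orientations for each edge) to $\mathbb{T}$ with $\phi(e_{ij})=\phi(e_{ji})^{-1}$. For $\zeta:V\to\mathbb{T}$, the switched gain graph is $\Phi^\zeta=(\Gamma,\phi^\zeta)$ with $\phi^\zeta(e_{ij})=\zeta(v_i)^{-1}\phi(e_{ij})\zeta(v_j)$. The switching class $[\Phi]$ is the set of all $\Phi^\zeta$. An incidence phase function on $\Gamma$ is a function $\omega:V\times E\to\mathbb{T}\cup\{0\}$ with $\omega(v,e)\neq0$ if $v$ is incident to $e$ and $\omega(v,e)=0$ otherwise. The gain graph $\Phi(\omega)$ associated to $\omega$ has gains $$\phi(e_{ij})=\omega(v_i,e_{ij})\cdot\mathfrak{s}\cdot\omega(v_j,e_{ij})^{-1}.$$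 An orientation of $\Phi$ is an incidence phase function $\omega$ with $\Phi(\omega)=\Phi$. Let $\Lambda_\Gamma$ be the usual line graph of $\Gamma$ (vertices are the edges of $\Gamma$; two distinct edges are adjacent iff they share an endpoint). Given $\omega$ on $\Gamma$, define an incidence phase function $\omega_\Lambda$ on $\Lambda_\Gamma$ as follows: if $e,f$ are distinct edges of $\Gamma$ sharing the (unique) vertex $v$, then for the edge $ef$ of $\Lambda_\Gamma$ set $\omega_\Lambda(e,ef)=\omega(v,e)^{-1}$ and $\omega_\Lambda(f,ef)=\omega(v,f)^{-1}$; $\omega_\Lambda$ is $0$ on non-incident pairs. $\Phi(\omega_\Lambda)$ is the gain graph on $\Lambda_\Gamma$ whose gains are computed from $\omega_\Lambda$ by the displayed formula with the same $\mathfrak{s}$. The line graph $\Lambda(\Phi)$ of $\Phi$ is the switching class $[\Phi(\omega_\Lambda)]$, where $\omega$ is any orientation of $\Phi$ (the class does not depend on the choice of $\omega$). The adjacency matrix $A(\Psi)$ of a gain graph $\Psi$ with gain function $\psi$ has $(i,j)$ entry $\psi(e_{ij})$ if the $i$-th and $j$-th vertices are adjacent and $0$ otherwise; it is Hermitian. $A(\Lambda(\Phi))$ means $A(\Psi)$ for a representative $\Psi\in\Lambda(\Phi)$; its eigenvalues do not depend on the representative. *)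

(* Defs.v *)
From HB Require Import structures.
From mathcomp Require Import all_boot all_order all_algebra.
From mathcomp Require Import reals complex.

Set Implicit Arguments.
Unset Strict Implicit.
Unset Printing Implicit Defensive.

Import Order.TTheory GRing.Theory Num.Theory.
Local Open Scope ring_scope.

Record sgraph := SGraph {
  vertex :> finType;
  adj : rel vertex;
  adj_sym : symmetric adj;
  adj_irrefl : irreflexive adj }.

Definition is_edge (G : sgraph) (A : {set G}) : bool :=
  [exists x : G, exists y : G, adj x y && (A == [set x; y])].

Definition edge (G : sgraph) : finType := {A : {set G} | is_edge A}.

Definition ends (G : sgraph) (e : edge G) : {set G} := sval e.

Definition line_adj (G : sgraph) : rel (edge G) :=
  fun e f => (e != f) && [exists v : G, (v \in ends e) && (v \in ends f)].

Lemma line_adj_sym (G : sgraph) : symmetric (@line_adj G).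
Proof.
move=> e f; rewrite /line_adj eq_sym; congr (_ && _).
by apply: eq_existsb => v; rewrite andbC.
Qed.

Lemma line_adj_irrefl (G : sgraph) : irreflexive (@line_adj G).
Proof. by move=> e; rewrite /line_adj eqxx. Qed.

Definition line_graph (G : sgraph) : sgraph :=
  SGraph (@line_adj_sym G) (@line_adj_irrefl G).

Definition in_circle (R : realType) (z : R[i]) : bool := `|z| == 1.

(* The distinguished element of the gain group; the superscript 1 in T^1. *)
Definition dist_elt (R : realType) : R[i] := 1.

(* Oriented edges are the pairs (x, y) with adj x y; the values of gain on
   non-adjacent pairs are irrelevant and never used. *)
Record gain_graph (R : realType) (G : sgraph) := GainGraph {
  gain : G -> G -> R[i];
  gain_circle : forall x y, adj x y -> in_circle (gain x y);
  gain_inv : forall x y, adj x y -> gain x y = (gain y x)^-1 }.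

Definition gain_eq (R : realType) (G : sgraph) (Phi Psi : gain_graph R G) :=
  forall x y, adj x y -> gain Phi x y = gain Psi x y.

Definition in_switching_class (R : realType) (G : sgraph)
    (Phi Psi : gain_graph R G) : Prop :=
  exists2 zeta : G -> R[i], (forall x, in_circle (zeta x)) &
    forall x y, adj x y -> gain Psi x y = (zeta x)^-1 * gain Phi x y * zeta y.

Record inc_phase (R : realType) (G : sgraph) := IncPhase {
  phase : G -> edge G -> R[i];
  phase_circle : forall v e, v \in ends e -> in_circle (phase v e);
  phase_out : forall v e, v \notin ends e -> phase v e = 0 }.

(* insub [set x; y] is Some of the edge xy if x and y are adjacent, and None
   otherwise. *)
Definition phase_gain (R : realType) (G : sgraph) (w : inc_phase R G)
    (x y : G) : R[i] :=
  if insub [set x; y] : option (edge G) is Some e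
  then phase w x e * dist_elt R * (phase w y e)^-1 else 0.

Lemma adj_is_edge (G : sgraph) (x y : G) : adj x y -> is_edge [set x; y].
Proof. by move=> xy; apply/existsP; exists x; apply/existsP; exists y; rewrite xy eqxx. Qed.

Lemma phase_gain_circle (R : realType) (G : sgraph) (w : inc_phase R G) x y :
  adj x y -> in_circle (phase_gain w x y).
Proof.
move=> xy; rewrite /phase_gain (insubT (@is_edge G) (adj_is_edge xy)).
have /eqP wx := phase_circle w (v := x) (e := Sub _ (adj_is_edge xy)) (set21 x y).
have /eqP wy := phase_circle w (v := y) (e := Sub _ (adj_is_edge xy)) (set22 x y).
by rewrite /in_circle /dist_elt mulr1 normrM normfV wx wy invr1 mulr1.
Qed.

Lemma phase_gain_inv (R : realType) (G : sgraph) (w : inc_phase R G) x y :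
  adj x y -> phase_gain w x y = (phase_gain w y x)^-1.
Proof.
move=> xy; rewrite /phase_gain (setUC [set y]).
by case: insubP => [e _ _|_]; rewrite ?invr0 // /dist_elt !mulr1 invfM invrK mulrC.
Qed.

Definition gain_of_phase (R : realType) (G : sgraph) (w : inc_phase R G) :
    gain_graph R G :=
  GainGraph (@phase_gain_circle R G w) (@phase_gain_inv R G w).

Definition is_orientation (R : realType) (G : sgraph) (Phi : gain_graph R G)
    (w : inc_phase R G) : Prop :=
  gain_eq (gain_of_phase w) Phi.

(* An edge h of the line graph is a pair {e, f} of distinct edges of G with a
   unique common vertex, which is the vertex v picked here. *)
Definition line_phase_fun (R : realType) (G : sgraph) (w : inc_phase R G)
    (e : line_graph G) (h : edge (line_graph G)) : R[i] :=
  if e \in ends h then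
    if [pick v : G | [forall f in ends h, v \in ends f]] is Some v
    then (phase w v e)^-1 else 0
  else 0.

Lemma edge_inter_uniq (G : sgraph) (e f : edge G) (u v : G) : e != f ->
  u \in ends e -> u \in ends f -> v \in ends e -> v \in ends f -> u = v.
Proof.
move=> ef ue uf ve vf; apply/eqP; apply/negPn/negP => uv.
have edgeE (g : edge G) : u \in ends g -> v \in ends g -> ends g = [set u; v].
  move=> ug vg; have /existsP[a /existsP[b /andP[_ /eqP gE]]] : is_edge (ends g) :=
    valP g.
  by apply/esym/eqP; rewrite eqEcard subUset !sub1set ug vg cards2 uv gE cards2;
    case: (a != b).
move/eqP: ef; apply; apply: val_inj.
by rewrite -[LHS]/(ends e) -[RHS]/(ends f) (edgeE e) // (edgeE f).
Qed.

Lemma line_phaseE (R : realType) (G : sgraph) (w : inc_phase R G)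
    (e f : edge G) (h : edge (line_graph G)) (v : G) :
  e != f -> ends h = [set e; f] -> v \in ends e -> v \in ends f ->
  line_phase_fun w e h = (phase w v e)^-1.
Proof.
move=> ef hE ve vf; rewrite /line_phase_fun hE set21.
case: pickP => [u /forallP uh|/(_ v)/negbT/forallP[] g].
  have /implyP/(_ (set21 e f)) ue := uh e.
  have /implyP/(_ (set22 e f)) uf := uh f.
  by rewrite (edge_inter_uniq ef ue uf ve vf).
by apply/implyP; rewrite !inE => /orP[]/eqP->.
Qed.

Lemma line_phase_circle (R : realType) (G : sgraph) (w : inc_phase R G)
    (e : line_graph G) (h : edge (line_graph G)) :
  e \in ends h -> in_circle (line_phase_fun w e h).
Proof.
have /existsP[a /existsP[b /andP[/andP[ab /existsP[v /andP[va vb]]] /eqP hE]]]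
  : is_edge (ends h) := valP h.
rewrite hE !inE => /orP[]/eqP->.
  rewrite (line_phaseE w ab hE va vb) /in_circle normfV.
  by rewrite (eqP (phase_circle w va)) invr1.
rewrite eq_sym in ab; rewrite setUC in hE.
rewrite (line_phaseE w ab hE vb va) /in_circle normfV.
by rewrite (eqP (phase_circle w vb)) invr1.
Qed.

Lemma line_phase_out (R : realType) (G : sgraph) (w : inc_phase R G)
    (e : line_graph G) (h : edge (line_graph G)) :
  e \notin ends h -> line_phase_fun w e h = 0.
Proof. by rewrite /line_phase_fun => /negbTE->. Qed.

Definition line_phase (R : realType) (G : sgraph) (w : inc_phase R G) :
    inc_phase R (line_graph G) :=
  IncPhase (@line_phase_circle R G w) (@line_phase_out R G w).

(* The line graph of Phi, as a set of gain graphs. Every Phi has an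
   orientation and all orientations give the same class, so that quantifying
   existentially over w describes exactly that class. *)
Definition line_gain_class (R : realType) (G : sgraph) (Phi : gain_graph R G)
    (Psi : gain_graph R (line_graph G)) : Prop :=
  exists2 w : inc_phase R G, is_orientation Phi w &
    in_switching_class (gain_of_phase (line_phase w)) Psi.

Definition adjacency (R : realType) (G : sgraph) (Psi : gain_graph R G) :
    'M[R[i]]_#|G| :=
  \matrix_(i, j) if adj (enum_val i) (enum_val j)
                 then gain Psi (enum_val i) (enum_val j) else 0.

(* Main.v *)
Require Import Defs.
From mathcomp Require Import all_boot all_order all_algebra.
From mathcomp Require Import reals complex.

(** The bound holds because A(Psi) + 2 I is a Gram matrix, as for ordinary line
    graphs. Let w be the orientation and zeta the switching function from which
    Psi is obtained, and weight the incidence matrix of the graph by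
      N(e, v) = conj (w(v, e) zeta(e)),
    with one row per edge and one column per vertex. On the unit circle the
    inverse is the conjugate, so the product of the rows e and f of N
    is a sum over the common vertices of e and f of
      zeta(e)^-1 w(v, e)^-1 w(v, f) zeta(f).
    For e = f it has two terms, both equal to 1; for adjacent e and f the
    single common vertex contributes exactly the gain of the pair (e, f); for
    the other pairs it is empty ([weighted_incidence_gram]). A Gram matrix has
    only nonnegative eigenvalues, hence lambda + 2 >= 0
    ([eigenvalue_shifted_gram]). *)

Set Implicit Arguments.
Unset Strict Implicit.
Unset Printing Implicit Defensive.

Import Order.TTheory GRing.Theory Num.Theory.
Local Open Scope ring_scope.
Local Open Scope sesquilinear_scope.

(** If x is an eigenvector, then (a + c) <x, x> = x B B^* x^* = <x B, x B>, and
    both squared norms are nonnegative while <x, x> is nonzero. *)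
Lemma eigenvalue_shifted_gram (C : numClosedFieldType) (m n : nat)
    (M : 'M[C]_m) (B : 'M[C]_(m, n)) (a c : C) :
  M + c%:M = B *m B^t* -> eigenvalue M a -> - c <= a.
Proof.
move=> gramE /eigenvalueP[x xM x_neq0].
have normE : dotmx (x *m B) (x *m B) = (a + c) * dotmx x x.
  rewrite !dotmxE trmx_mul map_mxM mulmxA -(mulmxA x) -gramE mulmxDr xM.
  by rewrite mul_mx_scalar -scalerDl -scalemxAl mxE.
have x_gt0 : 0 < dotmx x x by rewrite dnorm_gt0.
by rewrite -subr_ge0 opprK -(pmulr_lge0 _ x_gt0) -normE dnorm_ge0.
Qed.

Section LineGraph.

Variables (R : realType) (G : sgraph).
Implicit Types (w : inc_phase R G) (e f : edge G).

Lemma circle_conj (z : R[i]) : in_circle z -> Num.conj z = z^-1.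
Proof. by move=> /eqP z1; rewrite invC_norm z1 expr1n invr1 mul1r. Qed.

Lemma circle_neq0 (z : R[i]) : in_circle z -> z != 0.
Proof. by move=> /eqP z1; rewrite -normr_eq0 z1 oner_eq0. Qed.

Lemma card_ends e : #|ends e| = 2.
Proof.
have /existsP[x /existsP[y /andP[xy /eqP eE]]] : is_edge (ends e) := valP e.
rewrite eE cards2; case: eqVneq xy => // ->.
by rewrite adj_irrefl.
Qed.

Lemma line_phase_gainE w e f (v : G) :
    e != f -> v \in ends e -> v \in ends f ->
  phase_gain (line_phase w) (e : line_graph G) f
    = (phase w v e)^-1 * phase w v f.
Proof.
move=> ef ve vf.
have ef_adj : line_adj e f.
  by rewrite /line_adj ef; apply/existsP; exists v; rewrite ve vf.
rewrite /phase_gain (insubT _ (adj_is_edge (G := line_graph G) ef_adj)) /=.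
rewrite (line_phaseE w ef _ ve vf) //.
rewrite eq_sym in ef.
by rewrite (line_phaseE w ef _ vf ve) ?invrK /dist_elt ?mulr1 //= setUC.
Qed.

Lemma sum_phase_conj w e :
  \sum_v Num.conj (phase w v e) * phase w v e = 2%:R.
Proof.
rewrite (bigID (mem (ends e))) /= [X in _ + X]big1 ?addr0; last first.
  by move=> v /phase_out->; rewrite mulr0.
rewrite (eq_bigr (fun=> 1)) ?sumr_const ?card_ends // => v /phase_circle ve.
by rewrite circle_conj // mulVf // circle_neq0.
Qed.

(** Distinct edges have at most one common vertex, so at most one term of the
    sum survives, and it is the gain in the line graph. *)
Lemma sum_phase_conj_line w e f : e != f ->
  \sum_v Num.conj (phase w v e) * phase w v f =
    if line_adj e f then phase_gain (line_phase w) (e : line_graph G) f else 0.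
Proof.
move=> ef; rewrite /line_adj ef /=.
case: existsP => [[v /andP[ve vf]]|no_common].
  rewrite (bigD1 v) //= big1 ?addr0 => [|u uv].
    by rewrite (line_phase_gainE w ef ve vf) circle_conj ?phase_circle.
  have [ue|/phase_out->] := boolP (u \in ends e); last by rewrite conjC0 mul0r.
  have [uf|/phase_out->] := boolP (u \in ends f); last by rewrite mulr0.
  by rewrite (edge_inter_uniq ef ue uf ve vf) eqxx in uv.
apply: big1 => v _.
have [ve|/phase_out->] := boolP (v \in ends e); last by rewrite conjC0 mul0r.
have [vf|/phase_out->] := boolP (v \in ends f); last by rewrite mulr0.
by case: no_common; exists v; rewrite ve vf.
Qed.

Definition weighted_incidence w (zeta : edge G -> R[i]) :
    'M[R[i]]_(#|line_graph G|, #|G|) :=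
  \matrix_(i, j)
    Num.conj (phase w (enum_val j) (enum_val i) * zeta (enum_val i)).

Lemma weighted_incidence_gram w (zeta : line_graph G -> R[i])
    (Psi : gain_graph R (line_graph G)) :
    (forall e : line_graph G, in_circle (zeta e)) ->
    (forall e f : line_graph G, adj e f -> gain Psi e f
       = (zeta e)^-1 * gain (gain_of_phase (line_phase w)) e f * zeta f) ->
  adjacency Psi + 2%:R%:M =
    weighted_incidence w zeta *m (weighted_incidence w zeta)^t*.
Proof.
move=> zeta1 PsiE; apply/matrixP => i j; rewrite !mxE.
set e : edge G := enum_val i; set f : edge G := enum_val j.
transitivity ((zeta e)^-1
    * (\sum_v Num.conj (phase w v e) * phase w v f) * zeta f); last first.
  rewrite mulr_sumr mulr_suml big_enum_val; apply: eq_bigr => k _.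
  by rewrite !mxE conjCK rmorphM /= (circle_conj (zeta1 e)) !mulrA (mulrC _^-1).
have [ij|ij] := eqVneq i j.
  rewrite /f -ij -/e sum_phase_conj mulr1n adj_irrefl add0r mulrAC.
  by rewrite mulVf ?circle_neq0 // mul1r.
have ef : e != f by rewrite (inj_eq enum_val_inj).
rewrite addr0 (sum_phase_conj_line w ef) /=.
have [ef_adj|_] := boolP (line_adj e f); last by rewrite mulr0 mul0r.
by rewrite PsiE.
Qed.

End LineGraph.

Theorem theorem5p5 (R : realType) (G : sgraph) (Phi : gain_graph R G)
    (Psi : gain_graph R (line_graph G)) (lambda : R[i]) :
  line_gain_class Phi Psi ->
  eigenvalue (adjacency Psi) lambda ->
  (- 2%:R <= lambda)%R.
Proof.
move=> [w _ [zeta zeta1 PsiE]].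
exact: eigenvalue_shifted_gram (weighted_incidence_gram zeta1 PsiE).
Qed.
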